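(* Let $q\ge 2$ be an integer, let $T$ be the infinite homogeneous tree in which every vertex has exactly $q+1$ neighbours, with a fixed root $0$, and let $(X_n)_{n\ge 0}$ be the simple random walk on $T$. Then: (a) the hitting vector of the root is $\left(q^{-|x|}\right)_{x\in T}$, i.e. $P_x(\tau_0<\infty)=q^{-|x|}$ for all $x\in T$; (b) the hitting vector of an arbitrary point $a\in T$ is $\left(q^{-d(a,x)}\right)_{x\in T}$, i.e. $P_x(\tau_a<\infty)=q^{-d(a,x)}$ for all $x\in T$; (c) for any starting point $a\in T$ and any edge $xy$ (with $x\sim y$), the expected number of transitions from $x$ to $y$ is $$E_a[S_{xy}]=\frac{q}{q^2-1}\,q^{-d(a,x)}.$$
   Context: $T$ also denotes the vertex set of the tree; $x\sim y$ means that $x,y$ are neighbours; $d(a,x)$ is the number of edges of the geodesic path from $a$ to $x$, and $|x|=d(0,x)$. The simple random walk on $T$ is the Markov chain with transition probabilities $p_{xy}=\frac{1}{q+1}$ if $y\sim x$ and $p_{xy}=0$ otherwise; $P_x$ and $E_x$ denote probability and expectation for the chain started at $X_0=x$. The hitting time of a vertex $a$ is $\tau_a=\inf\{n\ge 0: X_n=a\}$ (with $\inf\emptyset=\infty$), and the hitting vector of $a$ is $\left(P_x(\tau_a<\infty)\right)_{x\in T}$. For $x\sim y$, the transitions number from $x$ to $y$ (in one step) is $$S_{xy}=\sum_{n\ge 0}\mathbf 1_{\{X_n=x,\;X_{n+1}=y\}}.$$ *)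

(* Defs.v *)
From mathcomp Require Import all_boot all_order all_algebra.
From mathcomp Require Import all_classical all_reals all_analysis.

Set Implicit Arguments.
Unset Strict Implicit.
Unset Printing Implicit Defensive.

Import Order.TTheory GRing.Theory Num.Theory.

Local Open Scope classical_set_scope.
Local Open Scope ring_scope.

Section Tree.
Context (V : eqType).
Implicit Types (adj : rel V) (x y : V) (q n : nat).

Definition connected_graph adj : Prop :=
  forall x y, exists p : seq V, path adj x p /\ last x p = y.

(* Traversing an edge back and forth is a [ucycle] of size 2 but not a cycle of
   the graph, hence the bound on the size. *)
Definition acyclic_graph adj : Prop :=
  forall c : seq V, (2 < size c)%N -> ~ ucycle adj c.

Definition is_tree adj : Prop :=
  [/\ symmetric adj, irreflexive adj, connected_graph adj & acyclic_graph adj].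

Definition homogeneous_tree q adj : Prop :=
  [/\ is_tree adj, infinite_set [set: V] &
      forall x, ([set y | adj x y] #= `I_q.+1)%card].

Definition walk_length adj x y n : Prop :=
  exists p : seq V, [/\ path adj x p, last x p = y & size p = n].

(* Length of a shortest path; the default value of [get] is only used when x
   and y are not connected. *)
Definition dist adj x y : nat :=
  [get n | walk_length adj x y n /\
           forall m, walk_length adj x y m -> (n <= m)%N].

End Tree.

Section Walk.
Context (V : eqType) (R : realType) (d : measure_display)
  (Omega : measurableType d).
Implicit Types (P : probability Omega R) (X : nat -> Omega -> V).

(* The state space carries the discrete sigma-algebra.  The last clause is
   P(X_(n+1) = s_(n+1) | X_0 = s_0, ..., X_n = s_n) = p(s_n, s_(n+1)), multiplied
   out so that it is also meaningful when the conditioning event is null. *)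
Definition markov_chain (p : V -> V -> R) (x0 : V) P X : Prop :=
  [/\ forall n (A : set V), measurable (X n @^-1` A),
      P [set w | X 0%N w = x0] = 1%E &
      forall n (s : nat -> V),
        P [set w | forall k, (k <= n.+1)%N -> X k w = s k] =
        (P [set w | forall k, (k <= n)%N -> X k w = s k] *
         (p (s n) (s n.+1))%:E)%E].

Definition srw_transition (q : nat) (adj : rel V) (x y : V) : R :=
  if adj x y then q.+1%:R^-1 else 0.

Definition simple_random_walk (q : nat) (adj : rel V) (x0 : V) P X : Prop :=
  markov_chain (srw_transition q adj) x0 P X.

Definition hitting_time X (a : V) (w : Omega) : \bar R :=
  ereal_inf [set n%:R%:E | n in [set n : nat | X n w = a]].

Definition hitting_prob P X (a : V) : \bar R :=
  P [set w | (hitting_time X a w < +oo)%E].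

Definition transitions_number X (x y : V) (w : Omega) : \bar R :=
  (\sum_(0 <= n <oo) (\1_[set v | X n v = x /\ X n.+1 v = y] w)%:E)%E.

(* [transitions_number] may be infinite, so its expectation is written as an
   integral: the library's ['E_P[_]] only takes real-valued functions. *)
Definition expected_transitions P X (x y : V) : \bar R :=
  (\int[P]_w transitions_number X x y w)%E.

End Walk.

(* Main.v *)
(* Let [M] average a function over the [q + 1] neighbours of a vertex.  Seen
   from [a], a vertex other than [a] has exactly one neighbour closer to [a]
   (two would close a cycle), so [M] acts on radial functions as a birth-death
   chain.  By first-step analysis the probabilities of hitting [a] within [n]
   steps, and the expected numbers of transitions during the first [n] steps,
   obey a recursion driven by [M], whose fixed point is a multiple of
   [q^-d(a, .)].  For [1/q < t < 1] one has [M t^d <= rho t^d] with [rho < 1],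
   and the initial error is at most [C t^d]; hence the error after [n] steps is
   at most [C rho^n t^d] and the recursions converge to the fixed points.

   The law of [X_0, ..., X_n] is uniform on the [(q + 1)^n] trajectories issued
   from the starting point, so every probability about it is a finite average.
   That these trajectories carry full mass replaces countability of [V]. *)
Require Import Defs.
From mathcomp Require Import all_boot all_order all_algebra zify ring lra.
From mathcomp Require Import all_classical all_reals all_analysis measurable_realfun.

Set Implicit Arguments.
Unset Strict Implicit.
Unset Printing Implicit Defensive.

Import Order.TTheory GRing.Theory Num.Theory.
Import numFieldNormedType.Exports.

Local Open Scope classical_set_scope.
Local Open Scope ring_scope.

(** * Distances and geodesics in a tree *)

Section Tree.
Context (V : eqType) (adj : rel V).
Hypothesis adj_sym : symmetric adj.
Hypothesis adj_irr : irreflexive adj.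
Hypothesis adj_conn : connected_graph adj.
Hypothesis adj_acyc : acyclic_graph adj.

Lemma distP x y : walk_length adj x y (dist adj x y) /\
  forall m, walk_length adj x y m -> (dist adj x y <= m)%N.
Proof.
apply: (@getPex _ [set n | walk_length adj x y n /\
  forall m, walk_length adj x y m -> (n <= m)%N]) => /=.
have [p [px py]] := adj_conn x y.
have ex : exists n, `[< walk_length adj x y n >].
  by exists (size p); apply/asboolP; exists p.
have [m /asboolP mw mmin] := ex_minnP ex.
by exists m; split => // k kw; apply: mmin; apply/asboolP.
Qed.

Lemma dist_walk x y : walk_length adj x y (dist adj x y).
Proof. by case: (distP x y). Qed.

Lemma dist_le x y n : walk_length adj x y n -> (dist adj x y <= n)%N.
Proof. by case: (distP x y) => _; apply. Qed.

Lemma rev_walk x p : path adj x p ->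
  path adj (last x p) (rev (belast x p)) /\
  last (last x p) (rev (belast x p)) = x.
Proof.
move=> px; split; last by case: p px => //= y p _; rewrite rev_cons last_rcons.
by rewrite rev_path (eq_path (e' := adj)) // => u v; rewrite adj_sym.
Qed.

Lemma dist_sym x y : dist adj x y = dist adj y x.
Proof.
suff h u v : (dist adj u v <= dist adj v u)%N by apply/eqP; rewrite eqn_leq !h.
have [p [pv <- <-]] := dist_walk v u; apply: dist_le.
have [? ?] := rev_walk pv; exists (rev (belast v p)).
by split=> //; rewrite size_rev size_belast.
Qed.

Lemma dist_xx x : dist adj x x = 0%N.
Proof. by apply/eqP; rewrite -leqn0; apply: dist_le; exists [::]. Qed.

Lemma dist_eq0 x y : dist adj x y = 0%N -> x = y.
Proof. by move=> d0; have := dist_walk x y; rewrite d0 => -[[|z p] []]. Qed.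

Lemma dist_adj a x y : adj x y -> (dist adj a y <= (dist adj a x).+1)%N.
Proof.
move=> xy; have [p [pa px <-]] := dist_walk a x; apply: dist_le.
by exists (rcons p y); rewrite rcons_path pa px last_rcons size_rcons.
Qed.

Lemma dist_pred a x : x != a ->
  exists2 y, adj x y & (dist adj a y).+1 = dist adj a x.
Proof.
move=> xa; have [p [pa]] := dist_walk a x.
case/lastP: p pa => [_ /= ax|p z]; first by rewrite ax eqxx in xa.
rewrite rcons_path last_rcons size_rcons => /andP[pa pz] zx sp.
rewrite -zx in sp *; exists (last a p); first by rewrite adj_sym.
apply/eqP; rewrite eqn_leq dist_adj// andbT -sp ltnS.
by apply: dist_le; exists p.
Qed.

(** A geodesic from [a] to [y] meeting [x] has an initial piece of length at least [dist adj a x].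
    As [y] is no farther than [x], that piece is the whole geodesic, so [x = y], against
    irreflexivity. *)
Lemma short_walk_avoids a x y : adj x y -> (dist adj a y <= dist adj a x)%N ->
  exists p, [/\ path adj a p, last a p = y & x \notin a :: p].
Proof.
move=> xy dyx; have [p [pa py sp]] := dist_walk a y.
exists p; split=> //; apply/negP => xp.
have := pa; case/splitPl: xp sp py => p1 p2 xp1 sp py.
rewrite cat_path => /andP[pa1 _].
have dx : (dist adj a x <= size p1)%N by apply: dist_le; exists p1.
move: sp; rewrite size_cat => sp.
have p20 : p2 = [::] by apply/eqP; rewrite -size_eq0; move: sp dyx dx; lia.
by move: py xy; rewrite p20 cats0 xp1 => ->; rewrite adj_irr.
Qed.

(* Otherwise two geodesics to [a] close up with [x] into a cycle. *)
Lemma closer_nbr_unique a x y y' : adj x y -> adj x y' ->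
  (dist adj a y <= dist adj a x)%N -> (dist adj a y' <= dist adj a x)%N ->
  y = y'.
Proof.
move=> xy xy' dy dy'; apply/eqP/negPn/negP => yy'.
have [p [pa py xp]] := short_walk_avoids xy dy.
have [p' [pa' py' xp']] := short_walk_avoids xy' dy'.
have [rp rl] := rev_walk pa; rewrite py in rp rl.
have : path adj y (rev (belast a p) ++ p') by rewrite cat_path rp rl.
have : last y (rev (belast a p) ++ p') = y' by rewrite last_cat rl.
have : x \notin y :: rev (belast a p) ++ p'.
  move: xp xp'; rewrite lastI py mem_rcons !inE mem_cat mem_rev !negb_or.
  by move=> /andP[-> ->] /andP[_ ->].
move=> + + w; case/shortenP: w => c yc uc sub xc cy'.
apply: (adj_acyc (c := x :: y :: c)).
  (* An empty [c] would force [y = y'], so the cycle [x :: y :: c] has at least three vertices. *)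
  by case: c yc uc sub cy' => [|//] _ _ _ /= cy'; rewrite cy' eqxx in yy'.
rewrite /ucycle [cycle _ _]/= xy rcons_path yc cy' adj_sym xy' /=.
move: uc => /= ->; rewrite andbT; apply: contra xc.
by rewrite !inE => /orP[->//|/sub ->]; rewrite orbT.
Qed.

End Tree.

(* [t ^+ dist] is a strict supersolution, with [q^-1 < t = 2 / (q + 1) < 1]. *)
Lemma supersolution_rate (R : realType) (q : nat) : (2 <= q)%N ->
  exists t rho : R, [/\ 0 < t, q%:R^-1 <= t, t <= rho, rho < 1 &
    t^-1 + q%:R * t = q.+1%:R * rho].
Proof.
move=> hq; have q2 : 2 <= q%:R :> R by rewrite ler_nat.
have q1 : 0 < q%:R + 1 :> R by lra.
pose t : R := 2 / (q%:R + 1).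
have t0 : 0 < t by rewrite divr_gt0.
have t1 : t <= 1 by rewrite ler_pdivrMr// mul1r; lra.
exists t, ((t^-1 + q%:R * t) / (q%:R + 1)); rewrite -natr1; split => //.
- by rewrite ler_pdivlMr// mulrC ler_pdivrMr; lra.
- rewrite ler_pdivlMr// mulrDr mulr1 mulrC addrC lerD2r.
  by rewrite (le_trans t1)// invf_ge1.
(* Multiplied by [q + 1], the inequality becomes [(q + 1)^2 / 2 + 2 q < (q + 1)^2], that is
   [(q - 1)^2 > 0]. *)
- rewrite ltr_pdivrMr// mul1r /t invf_div -(ltr_pM2r q1) mulrDl.
  rewrite [X in _ + X](_ : _ = q%:R * 2); last by field; rewrite gt_eqF.
  by nra.
- by rewrite [RHS]mulrC divfK// gt_eqF.
Qed.

(** * Neighbour averages of radial functions *)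

Section Nbrs.
Context (V : eqType) (adj : rel V) (q : nat) (R : realType).
Hypothesis hq : (2 <= q)%N.
Hypothesis tree : is_tree adj.
Context (nbrs : V -> seq V).
Hypothesis nbrs_uniq : forall x, uniq (nbrs x).
Hypothesis size_nbrs : forall x, size (nbrs x) = q.+1.
Hypothesis mem_nbrs : forall x y, (y \in nbrs x) = adj x y.

Definition nbr_avg (f : V -> R) (x : V) : R :=
  q.+1%:R^-1 * \sum_(y <- nbrs x) f y.

(** Off [a], [dist_pred] gives one closer neighbour. The inequalities in [closer_nbr_unique] are not
    strict, so they also exclude neighbours at equal distance: the other [q] are all farther. *)
Lemma sum_nbrs_dist (phi : nat -> R) a x :
  \sum_(y <- nbrs x) phi (dist adj a y) =
  if x == a then q.+1%:R * phi 1%N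
  else phi (dist adj a x).-1 + q%:R * phi (dist adj a x).+1.
Proof.
have [asym airr aconn aacyc] := tree.
have sum_const (s : seq V) k : (forall y, y \in s -> dist adj a y = k) ->
    \sum_(y <- s) phi (dist adj a y) = (size s)%:R * phi k.
  move=> sk; rewrite (eq_big_seq (fun=> phi k)); last by move=> y /sk ->.
  by rewrite big_const_seq count_predT iter_addr addr0 mulr_natl.
have [->|xa] := eqVneq x a.
  rewrite (sum_const _ 1%N) ?size_nbrs// => y; rewrite mem_nbrs => ay.
  apply/eqP; rewrite eqn_leq lt0n.
  rewrite -{1}(dist_xx aconn a) (dist_adj aconn)//=.
  by apply/eqP => /(dist_eq0 aconn) ay'; rewrite ay' airr in ay.
have [z xz dz] := dist_pred asym aconn xa.
rewrite (big_rem z) ?mem_nbrs//= -dz /=; congr (_ + _).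
rewrite (sum_const _ (dist adj a z).+2) ?size_rem ?mem_nbrs ?size_nbrs// => y.
rewrite mem_rem_uniq// inE mem_nbrs => /andP[yz xy].
apply/eqP; rewrite eqn_leq dz (dist_adj aconn)// ltnNge /=.
apply: contra yz => dy; apply/eqP.
by apply: (closer_nbr_unique asym airr aconn aacyc xy xz dy); rewrite -dz.
Qed.

Lemma nbr_avgZ c f x : nbr_avg (fun y => c * f y) x = c * nbr_avg f x.
Proof. by rewrite /nbr_avg -mulr_sumr mulrCA. Qed.

Lemma nbr_avgB f g x :
  nbr_avg (fun y => f y - g y) x = nbr_avg f x - nbr_avg g x.
Proof. by rewrite /nbr_avg sumrB mulrBr. Qed.

Lemma ler_nbr_avg f g x : (forall y, f y <= g y) -> nbr_avg f x <= nbr_avg g x.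
Proof.
by move=> fg; rewrite /nbr_avg ler_wpM2l ?invr_ge0// ler_sum.
Qed.

Lemma ler_norm_nbr_avg f x : `|nbr_avg f x| <= nbr_avg (fun y => `|f y|) x.
Proof.
rewrite /nbr_avg normrM ger0_norm ?invr_ge0// ler_wpM2l ?invr_ge0//.
exact: ler_norm_sum.
Qed.

(** Harmonicity off [a] comes from [q + q * q^-1 = q + 1]. At [a] the average falls short of the
    value by [1 - q^-1]. *)
Lemma nbr_avg_powdist a x :
  nbr_avg (fun y => q%:R ^- dist adj a y) x =
  if x == a then q%:R^-1 else q%:R ^- dist adj a x.
Proof.
have [asym airr aconn aacyc] := tree.
have q0 : q%:R != 0 :> R by rewrite pnatr_eq0; lia.
rewrite /nbr_avg (sum_nbrs_dist (fun k => q%:R ^- k)).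
case: (eqVneq x a) => [_|/(dist_pred asym aconn)[z _ <-]].
  by rewrite mulKf ?pnatr_eq0.
rewrite /= !exprS -natr1; field.
by rewrite expf_neq0 // q0 natr1 pnatr_eq0.
Qed.

(** Averaging fixes constants, so it does not contract the sup norm; relative to the weight
    [t ^+ dist] it contracts by [rho]. The bound [q%:R^-1 <= t] places the initial error under this
    weight. *)
Lemma nbr_avg_contraction_cvg0 a (e : nat -> V -> R) C :
  (forall x, `|e 0%N x| <= C * q%:R ^- dist adj a x) ->
  (forall n x, `|e n.+1 x| <= nbr_avg (fun y => `|e n y|) x) ->
  forall x, e n x @[n --> \oo] --> (0 : R).
Proof.
move=> e0 eS x.
have [t [rho [t_gt0 qV_le_t t_le_rho rho_lt1 t_rho]]] := supersolution_rate R hq.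
have [asym airr aconn aacyc] := tree.
have C0 : 0 <= C.
  by have := le_trans (normr_ge0 _) (e0 a); rewrite dist_xx// expr0 invr1 mulr1.
have rho0 : 0 <= rho by rewrite (le_trans (ltW t_gt0)).
have bound n y : `|e n y| <= C * rho ^+ n * t ^+ dist adj a y.
  elim: n y => [|n IHn] y.
    rewrite expr0 mulr1 (le_trans (e0 y))// ler_wpM2l//.
    by rewrite -exprVn lerXn2r// nnegrE ?invr_ge0// ltW.
  apply: (le_trans (eS n y)).
  apply: (le_trans (ler_nbr_avg y (IHn))).
  rewrite nbr_avgZ exprSr [C * (_ * _)]mulrA -[leRHS]mulrA.
  rewrite ler_wpM2l ?mulr_ge0 ?exprn_ge0//.
  rewrite /nbr_avg (sum_nbrs_dist (GRing.exp t)).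
  (* At [a] the weight averages to [t <= rho]; elsewhere its average is exactly [rho] times the
     weight. *)
  case: (eqVneq y a) => [->|/(dist_pred asym aconn)[z _ <-]].
    by rewrite dist_xx// mulr1 expr1 mulKf ?pnatr_eq0.
  rewrite /= -(mulKf (_ : q.+1%:R != 0) rho) ?pnatr_eq0// -t_rho -mulrA.
  rewrite le_eqVlt; apply/orP; left; apply/eqP; congr (_ * _).
  by rewrite !exprS; field; rewrite gt_eqF.
apply/cvgr0Pnorm_le => eps eps0.
have : geometric (C * t ^+ dist adj a x) rho n @[n --> \oo] --> (0 : R).
  by apply: cvg_geometric; rewrite ger0_norm.
move/cvgr0Pnorm_le => /(_ _ eps0); apply: filterS => n.
apply: le_trans; rewrite (le_trans (bound n x))//.
by rewrite /= mulrAC ler_norm.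
Qed.

End Nbrs.

(** * Uniform law of finite trajectories *)

Lemma measure_mem_seq d (Omega : measurableType d) (R : realType)
    (P : {measure set Omega -> \bar R}) (T : eqType) (g : Omega -> T)
    (l : seq T) :
  uniq l -> (forall s, s \in l -> measurable [set w | g w = s]) ->
  measurable [set w | g w \in l] /\
  P [set w | g w \in l] = (\sum_(s <- l) P [set w | g w = s]%classic)%E.
Proof.
elim: l => [|s l IHl] /=.
  have -> : [set w | g w \in [::]] = set0 by rewrite seteqP; split.
  by rewrite measure0 big_nil.
move=> /andP[sl ul] ml.
have [ml' Pl'] := IHl ul (fun s' s'l => ml s' (mem_behead (s := s :: l) s'l)).
have -> : [set w | g w \in s :: l] =
    [set w | g w = s] `|` [set w | g w \in l].
  rewrite seteqP; split=> w /=; rewrite inE.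
    by case/orP=> [/eqP|]; [left|right].
  by case=> [->|->]; rewrite ?eqxx ?orbT.
have ms := ml _ (mem_head s l).
split; first exact: measurableU.
rewrite big_cons -Pl' measureU// -subset0 => w /= [gs].
by rewrite gs (negPf sl).
Qed.

Section Trajectories.
Context (V : eqType) (adj : rel V) (q : nat) (R : realType).
Context (nbrs : V -> seq V).
Hypothesis nbrs_uniq : forall x, uniq (nbrs x).
Hypothesis size_nbrs : forall x, size (nbrs x) = q.+1.
Hypothesis mem_nbrs : forall x y, (y \in nbrs x) = adj x y.

Fixpoint trajs (n : nat) (x : V) : seq (seq V) :=
  if n is m.+1 then flatten [seq [seq x :: s | s <- trajs m y] | y <- nbrs x]
  else [:: [:: x]].

Lemma mem_trajs x0 n x s : s \in trajs n x ->
  [/\ size s = n.+1, nth x0 s 0 = x &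
      forall k, (k < n)%N -> adj (nth x0 s k) (nth x0 s k.+1)].
Proof.
elim: n x s => [|n IHn] x s /=; first by rewrite inE => /eqP ->.
case/flatten_mapP => y yx /mapP[s' /IHn[ss' s'0 sadj] ->]; split=> //=.
  by rewrite ss'.
by case=> [_|k kn] /=; [rewrite s'0 -mem_nbrs|exact: sadj].
Qed.

Lemma size_trajs n x : size (trajs n x) = (q.+1 ^ n)%N.
Proof.
elim: n x => // n IHn x; rewrite /= size_flatten /shape -map_comp expnS.
rewrite sumnE big_map.
under eq_bigr => y _ do rewrite /= size_map IHn.
by rewrite big_const_seq count_predT iter_addn_0 size_nbrs mulnC.
Qed.

Lemma uniq_trajs n x : uniq (trajs n x).
Proof.
elim: n x => // n IHn x /=.
elim: (nbrs x) (nbrs_uniq x) => //= y l IHl /andP[yl ul].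
rewrite cat_uniq IHl// andbT map_inj_uniq ?IHn//=; last by move=> ? ? [].
apply/hasPn => s /flatten_mapP[z zl /mapP[u zu ->]].
apply/negP => /mapP[v yv [uv]]; rewrite uv in zu.
have [_ yv0 _] := mem_trajs x yv; have [_ zv0 _] := mem_trajs x zu.
by move: yl; rewrite -yv0 zv0 zl.
Qed.

Definition traj_avg (n : nat) (x : V) (f : seq V -> R) : R :=
  q.+1%:R ^- n * \sum_(s <- trajs n x) f s.

Lemma traj_avg0 x f : traj_avg 0 x f = f [:: x].
Proof. by rewrite /traj_avg big_seq1 expr0 invr1 mul1r. Qed.

(** The Markov property at time 1 in combinatorial form. The averages make sense from every vertex,
    so the recursions need the probability measure of one starting point only. *)
Lemma traj_avgS n x f :
  traj_avg n.+1 x f =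
  nbr_avg q nbrs (fun y => traj_avg n y (fun s => f (x :: s))) x.
Proof.
rewrite /traj_avg /nbr_avg /= big_flatten big_map -mulr_sumr mulrA -invfM -exprS.
by congr (_ * _); apply: eq_bigr => y _; rewrite big_map.
Qed.

Context (d : measure_display) (Omega : measurableType d)
  (P : probability Omega R) (X : nat -> Omega -> V) (x : V).
Hypothesis walk : simple_random_walk q adj x P X.

Definition traj (n : nat) (w : Omega) : seq V := mkseq (X^~ w) n.+1.

Lemma trajE x0 n s : size s = n.+1 ->
  [set w | traj n w = s] = [set w | forall k, (k <= n)%N -> X k w = nth x0 s k].
Proof.
move=> ss; rewrite seteqP; split=> w /= => [<- k kn|Xs].
  by rewrite nth_mkseq.
apply: (@eq_from_nth _ x0) => [|k]; rewrite size_mkseq ?ss// => kn.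
by rewrite nth_mkseq// Xs.
Qed.

Lemma measurable_traj n s : size s = n.+1 -> measurable [set w | traj n w = s].
Proof.
have [mX _ _] := walk.
move=> ss; rewrite (trajE x ss).
rewrite (_ : mkset _ = \bigcap_(k < n.+1) X k @^-1` [set nth x s k]).
  by apply: bigcap_measurableType => k _; exact: mX.
by rewrite seteqP; split.
Qed.

Lemma prob_cylinder n (s : nat -> V) : s 0%N = x ->
  (forall k, (k < n)%N -> adj (s k) (s k.+1)) ->
  P [set w | forall k, (k <= n)%N -> X k w = s k] = (q.+1%:R ^- n)%:E.
Proof.
have [_ X0 step] := walk; move=> s0.
elim: n => [|n IHn] sadj.
  rewrite expr0 invr1 -X0; congr (P _); rewrite seteqP; split=> w /=.
    by move=> /(_ 0%N isT); rewrite s0.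
  by move=> X0x k; rewrite leqn0 => /eqP ->; rewrite s0.
rewrite step IHn => [|k kn]; last by rewrite sadj// ltnW.
by rewrite /srw_transition sadj// -EFinM exprSr invfM mulrC.
Qed.

Lemma prob_traj n s : s \in trajs n x ->
  P [set w | traj n w = s] = (q.+1%:R ^- n)%:E.
Proof. by case/(mem_trajs x) => /(trajE x) -> s0 sadj; exact: prob_cylinder. Qed.

Lemma prob_mem_trajs n (l : seq (seq V)) : uniq l -> {subset l <= trajs n x} ->
  measurable [set w | traj n w \in l] /\
  P [set w | traj n w \in l] = (q.+1%:R ^- n * (size l)%:R)%:E.
Proof.
move=> ul lT.
have [|ml ->] := @measure_mem_seq _ _ _ P _ (traj n) _ ul.
  by move=> s /lT /(mem_trajs x)[ss _ _]; exact: measurable_traj.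
split=> //; rewrite (eq_big_seq (fun=> (q.+1%:R ^- n)%:E)).
  by rewrite sumEFin big_const_seq count_predT iter_addr addr0 mulr_natr.
by move=> s /lT; exact: prob_traj.
Qed.

(* [traj n] lies almost surely in the finite list [trajs n x], whose elements
   are equally likely. *)
Lemma prob_traj_event n (B : pred (seq V)) :
  measurable [set w | B (traj n w)] ->
  P [set w | B (traj n w)] = (traj_avg n x (fun s => (B s)%:R))%:E.
Proof.
move=> mB.
have [mT PT] := prob_mem_trajs (uniq_trajs n x) (fun=> id).
(* There are [(q + 1)^n] trajectories of mass [(q + 1)^-n] each, so they carry mass one. *)
rewrite size_trajs natrX mulVf ?expf_neq0 ?pnatr_eq0// in PT.
have [|mTB PTB] := @prob_mem_trajs n _ (filter_uniq B (uniq_trajs n x)).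
  by move=> s; rewrite mem_filter => /andP[].
rewrite (measureDI P mB mT).
rewrite [X in (X + _)%E](_ : _ = 0%E) ?add0e; last first.
  apply: (@subset_measure0 _ _ _ P _ (~` [set w | traj n w \in trajs n x])) => //.
  - exact: measurableD.
  - exact: measurableC.
  - by have := probability_setC P mT; rewrite PT subee.
rewrite (_ : _ `&` _ = [set w | traj n w \in [seq s <- trajs n x | B s]]).
  apply: etrans PTB _; rewrite /traj_avg size_filter; congr (_ * _)%:E.
  by rewrite -sum1_count natr_sum big_mkcond; apply: eq_bigr => s _; case: (B s).
rewrite seteqP; split=> w /=; rewrite mem_filter; first by case=> -> ->.
by case/andP.
Qed.

End Trajectories.

(** * Enumerating the neighbours *)

Lemma homogeneous_tree_nbrs (V : eqType) (q : nat) (adj : rel V) :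
  homogeneous_tree q adj -> exists nbrs : V -> seq V,
    [/\ forall x, uniq (nbrs x), forall x, size (nbrs x) = q.+1 &
        forall x y, (y \in nbrs x) = adj x y].
Proof.
case=> _ _ deg.
have ex x : exists s : seq V,
    [/\ uniq s, size s = q.+1 & forall y, (y \in s) = adj x y].
  have /card_set_bijP[f [fI finj fsurj]] := deg x.
  (* The implication makes the statement total in [k], as [choice] requires; beyond [q] the witness
     [x] is a dummy. *)
  have inv k : exists y, (k < q.+1)%N -> adj x y /\ f y = k.
    have [kq|] := boolP (k < q.+1)%N; last by exists x.
    by have [y xy fy] := fsurj k kq; exists y.
  have [g gP] := choice inv.
  exists [seq g k | k <- iota 0 q.+1]; split.
  - rewrite map_inj_in_uniq ?iota_uniq// => i j.
    rewrite !mem_iota /= !add0n => /gP[_ fi] /gP[_ fj] gij.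
    by rewrite -fi -fj gij.
  - by rewrite size_map size_iota.
  - move=> y; apply/mapP/idP => [[k]|xy].
      by rewrite mem_iota /= add0n => /gP[xk _] ->.
    have fq := fI y xy; exists (f y); first by rewrite mem_iota.
    have [xg fg] := gP (f y) fq.
    by apply: finj; rewrite ?inE.
have [nbrs nbrsP] := choice ex.
by exists nbrs; split=> x; case: (nbrsP x).
Qed.

(** * First-step recursions and their limits *)

Section Green.
Context (V : eqType) (adj : rel V) (q : nat) (R : realType).
Hypothesis hq : (2 <= q)%N.
Hypothesis tree : is_tree adj.
Context (nbrs : V -> seq V).
Hypothesis nbrs_uniq : forall x, uniq (nbrs x).
Hypothesis size_nbrs : forall x, size (nbrs x) = q.+1.
Hypothesis mem_nbrs : forall x y, (y \in nbrs x) = adj x y.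

Local Notation avg := (@nbr_avg V q R nbrs).
Local Notation tavg := (@traj_avg V q R nbrs).

Lemma traj_avg1 n x : tavg n x (fun=> 1) = 1.
Proof.
rewrite /traj_avg big_const_seq count_predT iter_addr addr0 (size_trajs size_nbrs).
by rewrite natrX mulVf// expf_neq0// pnatr_eq0.
Qed.

Definition hit_avg (a : V) (n : nat) (x : V) : R :=
  tavg n x (fun s => (a \in s)%:R).

Lemma hit_avgS a n x :
  hit_avg a n.+1 x = if x == a then 1 else avg (hit_avg a n) x.
Proof.
rewrite /hit_avg traj_avgS; case: (eqVneq x a) => [->|xa].
  under eq_fun do under eq_fun do rewrite mem_head.
  under eq_fun do rewrite traj_avg1.
  rewrite /nbr_avg big_const_seq count_predT iter_addr addr0 size_nbrs.
  by rewrite mulVf// pnatr_eq0.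
by under eq_fun do under eq_fun do rewrite inE eq_sym (negPf xa) /=.
Qed.

(** The error is always zero at [a] after the start too, so the failure of harmonicity there is
    harmless. Initially it is [- q^-d] off [a], whence the constant 1. *)
Lemma hit_avg_cvg a x :
  hit_avg a n x @[n --> \oo] --> (q%:R ^- dist adj a x : R).
Proof.
have [_ _ aconn _] := tree.
apply/subr_cvg0; apply: (nbr_avg_contraction_cvg0 hq tree nbrs_uniq size_nbrs
  mem_nbrs (a := a) (C := 1)
  (e := fun n x => hit_avg a n x - q%:R ^- dist adj a x)) => [{}x|n {}x].
  rewrite mul1r /hit_avg traj_avg0 inE eq_sym; case: (eqVneq x a) => [->|_].
    by rewrite dist_xx// expr0 invr1 subrr normr0.
  by rewrite sub0r normrN ger0_norm ?invr_ge0 ?exprn_ge0.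
rewrite hit_avgS; case: eqP => [->|/eqP/negPf xa].
  rewrite dist_xx// expr0 invr1 subrr normr0.
  exact: le_trans (normr_ge0 _) (ler_norm_nbr_avg _ _ _ _).
apply: le_trans (ler_norm_nbr_avg _ _ _ _).
by rewrite nbr_avgB (nbr_avg_powdist _ hq tree nbrs_uniq size_nbrs mem_nbrs) xa.
Qed.

(** Probability of crossing from [x] to [y] at time [n], which involves [n.+1] steps. The
    trajectories have [n.+2] entries, so the default of [nth] is never read. *)
Definition cross_avg (x y : V) (n : nat) (a : V) : R :=
  tavg n.+1 a (fun s => ((nth x s n == x) && (nth x s n.+1 == y))%:R).

Lemma cross_avg0 x y a : adj x y ->
  cross_avg x y 0 a = if a == x then q.+1%:R^-1 else 0.
Proof.
move=> xy; rewrite /cross_avg traj_avgS.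
under eq_fun do rewrite traj_avg0 /=.
rewrite /nbr_avg; case: (eqVneq a x) => [->|_]; last by rewrite big1 ?mulr0.
rewrite (bigD1_seq y) ?mem_nbrs//= eqxx big1 ?addr0 ?mulr1//.
by move=> z /negPf ->.
Qed.

Lemma cross_avgS x y n a : cross_avg x y n.+1 a = avg (cross_avg x y n) a.
Proof. by rewrite /cross_avg traj_avgS. Qed.

Lemma sum_cross_avgS x y n a :
  \sum_(m < n.+1) cross_avg x y m a =
  cross_avg x y 0 a + avg (fun z => \sum_(m < n) cross_avg x y m z) a.
Proof.
rewrite big_ord_recl; congr (_ + _); rewrite /nbr_avg exchange_big mulr_sumr.
by apply: eq_bigr => m _; exact: cross_avgS.
Qed.

(* [q / (q^2 - 1) * q^-d(x, .)] is the decaying solution of the first-step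
   equation satisfied by the sums. *)
Lemma sum_cross_avg_cvg x y a : adj x y ->
  \sum_(m < n) cross_avg x y m a @[n --> \oo] -->
  (q%:R / (q%:R ^+ 2 - 1) * q%:R ^- dist adj x a : R).
Proof.
move=> xy; have [_ _ aconn _] := tree.
(* The first-step equation at [x] reads [c = (q + 1)^-1 + c * q^-1], which determines [c]. *)
set c : R := q%:R / _.
have q2 : 2 <= q%:R :> R by rewrite ler_nat.
have qq : 0 < q%:R ^+ 2 - 1 :> R by nra.
have c0 : 0 <= c by rewrite divr_ge0// ltW.
apply/subr_cvg0; apply: (nbr_avg_contraction_cvg0 hq tree nbrs_uniq size_nbrs
  mem_nbrs (a := x) (C := c)
  (e := fun n a => \sum_(m < n) cross_avg x y m a - c * q%:R ^- dist adj x a))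
  => [{}a|n {}a].
  by rewrite big_ord0 sub0r normrN ger0_norm// divr_ge0// exprn_ge0.
apply: le_trans (ler_norm_nbr_avg _ _ _ _).
rewrite nbr_avgB nbr_avgZ (nbr_avg_powdist _ hq tree nbrs_uniq size_nbrs mem_nbrs).
rewrite sum_cross_avgS cross_avg0//; case: eqP => [->|_]; last by rewrite add0r.
rewrite dist_xx// expr0 invr1 mulr1 le_eqVlt; apply/orP; left; apply/eqP.
congr (`| _ |); rewrite /c -natr1; field.
by rewrite !gt_eqF//; lra.
Qed.

End Green.

(** * Passage from finite averages to the walk *)

Section Probabilities.
Context (V : eqType) (adj : rel V) (q : nat) (R : realType).
Hypothesis hq : (2 <= q)%N.
Hypothesis hT : homogeneous_tree q adj.
Context (d : measure_display) (Omega : measurableType d)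
  (P : probability Omega R) (X : nat -> Omega -> V) (x0 : V).
Hypothesis walk : simple_random_walk q adj x0 P X.

(** The infimum is infinite exactly when no visit occurs. The union is increasing, hence suited to
    continuity from below. *)
Lemma hitting_time_lty a :
  [set w | (hitting_time R X a w < +oo)%E] =
  \bigcup_n [set w | a \in traj X n w].
Proof.
rewrite seteqP; split=> w /=.
  move=> hw; have [[n Xn]|noX] := pselect (exists n, X n w = a).
    by exists n => //=; apply/mapP; exists n; rewrite ?mem_iota /=.
  move: hw; rewrite /hitting_time (_ : [set _ | _ in _] = set0).
    by rewrite ereal_inf0 ltxx.
  by rewrite -subset0 => z [n Xn _]; apply: noX; exists n.
case=> n _ /= /mapP[k _ aX].
by apply: le_lt_trans (ereal_inf_lbound _) (ltry k%:R); exists k.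
Qed.

Lemma hitting_probE a : hitting_prob P X a = (q%:R ^- dist adj a x0)%:E.
Proof.
have [tree _ _] := hT.
have [nbrs [nu ns nm]] := homogeneous_tree_nbrs hT.
have [mX _ _] := walk.
have mhit n : measurable [set w | a \in traj X n w].
  rewrite (_ : mkset _ = \bigcup_(k < n.+1) X k @^-1` [set a]).
    by apply: bigcup_measurable => k _; exact: mX.
  rewrite seteqP; split=> w /=.
    by case/mapP => k; rewrite mem_iota /= add0n => kn ->; exists k.
  by case=> k kn /= Xk; apply/mapP; exists k; rewrite ?mem_iota.
rewrite /hitting_prob hitting_time_lty.
have incr : {homo (fun n => [set w | a \in traj X n w]) :
    n m / (n <= m)%N >-> (n <= m)%O}.
  move=> n m nm'; apply/subsetPset => w /= /mapP[k].
  rewrite mem_iota /= add0n => kn ->.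
  by apply/mapP; exists k; rewrite ?mem_iota//= add0n (leq_trans kn).
(* Continuity from below: the probabilities of a visit by time [n] tend to the hitting
   probability. *)
have lim := nondecreasing_cvg_mu (mu := P) mhit (bigcupT_measurable _ mhit) incr.
have PE : P \o (fun n => [set w | a \in traj X n w]) =
    EFin \o (fun n => hit_avg q R nbrs a n x0).
  by apply/funext => n /=; exact: prob_traj_event (mhit n).
rewrite PE in lim; apply: (cvg_unique (@ereal_hausdorff R) lim).
by apply: cvg_EFin; [exact: nearW|exact: hit_avg_cvg].
Qed.

Lemma expected_transitionsE x y : adj x y ->
  expected_transitions P X x y =
  (q%:R / (q%:R ^+ 2 - 1) * q%:R ^- dist adj x0 x)%:E.
Proof.
move=> xy; have [tree _ _] := hT.
have [asym _ aconn _] := tree.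
have [nbrs [nu ns nm]] := homogeneous_tree_nbrs hT.
have [mX _ _] := walk.
pose cross n := [set v | X n v = x /\ X n.+1 v = y].
have mcross n : measurable (cross n).
  exact: (measurableI _ _ (mX n [set x]) (mX n.+1 [set y])).
have Pcross n : P (cross n) = (cross_avg q R nbrs x y n x0)%:E.
  pose B (s : seq V) := (nth x s n == x) && (nth x s n.+1 == y).
  have BE w : B (traj X n.+1 w) = (X n w == x) && (X n.+1 w == y).
    by rewrite /B !nth_mkseq.
  have crossE : cross n = [set w | B (traj X n.+1 w)].
    rewrite seteqP /cross; split=> w; rewrite /mkset BE.
      by case=> -> ->; rewrite !eqxx.
    by move=> /andP[/eqP -> /eqP ->].
  rewrite crossE (prob_traj_event nu ns nm walk)//.
  by rewrite -crossE.
(* Monotone convergence turns the expectation into the series of the crossing probabilities. *)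
rewrite /expected_transitions /transitions_number integral_nneseries//; last first.
  by move=> n; apply/measurable_EFinP; apply: measurable_indic; exact: mcross.
have intE n : (\int[P]_w (\1_(cross n) w)%:E)%E =
    (cross_avg q R nbrs x y n x0)%:E.
  by rewrite integral_indic// setIT; exact: Pcross.
rewrite (eq_eseriesr (fun n _ => intE n)).
apply/cvg_lim => //.
under eq_fun => n do rewrite sumEFin big_mkord.
apply: cvg_EFin; first exact: nearW.
(* The recursion varies the starting point, so its limit measures distances from [x]. *)
by rewrite (dist_sym asym aconn); exact: sum_cross_avg_cvg.
Qed.

End Probabilities.

Theorem proposition7p3 (R : realType) (q : nat) (hq : (2 <= q)%N)
    (V : eqType) (adj : rel V) (hT : homogeneous_tree q adj) (root : V)
    (d : measure_display) (Omega : measurableType d)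
    (P : V -> probability Omega R) (X : nat -> Omega -> V)
    (hX : forall x : V, simple_random_walk q adj x (P x) X) :
  [/\ forall x : V,
        hitting_prob (P x) X root = (q%:R ^- dist adj root x)%:E,
      forall a x : V,
        hitting_prob (P x) X a = (q%:R ^- dist adj a x)%:E &
      forall a x y : V, adj x y ->
        expected_transitions (P a) X x y =
        (q%:R / (q%:R ^+ 2 - 1) * q%:R ^- dist adj a x)%:E].
Proof.
split=> [x|a x|a x y xy]; first exact: hitting_probE (hX x) root.
  exact: hitting_probE (hX x) a.
exact: expected_transitionsE (hX a) x y xy.
Qed.
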